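(* Let $s\geq 4$ be an even integer and let $\overline{D}_{s}(n)$ denote the number of $s$-duplicate overpartitions of $n$. Then \[ \sum_{n\geq 0} \overline{D}_{s}(n) q^{n} = \frac{(-2q;q)_{\infty}(-q^{s/2};q^{s/2})_{\infty}}{(-2q^{s/2};q^{s/2})_{\infty} (q^{s/2};q^{s/2})_{\infty}}=\frac{(-2q;q)_{\infty}(q^{s};q^{s})_{\infty}}{(-2q^{s/2};q^{s/2})_{\infty} (q^{s/2};q^{s/2})^{2}_{\infty}}. \]
   Context: An overpartition of $n$ is a nonincreasing sequence of positive integers summing to $n$ in which the first occurrence of each distinct part value may optionally be overlined. An $s$-duplicate overpartition is an overpartition in which every part value occurring with multiplicity greater than one is divisible by $s/2$. Notation: $(a;q)_{\infty}=\prod_{i\geq 0}(1-aq^{i})$. *)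

(* Defs.v *)
From HB Require Import structures.
From mathcomp Require Import all_boot all_order all_algebra finmap.
From mathcomp Require Import all_classical.

Set Implicit Arguments.
Unset Strict Implicit.
Unset Printing Implicit Defensive.

Import GRing.Theory.

Local Open Scope ring_scope.

(* Formal power series.  A record rather than a bare function type, because
   [nat -> R] already carries the pointwise ring structure. *)

Record fps (R : Type) := FPS { fcoef :> nat -> R }.

Lemma fpsP (R : Type) (f g : fps R) : (forall n, f n = g n) -> f = g.
Proof. by case: f g => [f] [g] /= fg; congr FPS; apply/funext. Qed.

HB.instance Definition _ (R : Type) := gen_eqMixin (fps R).
HB.instance Definition _ (R : Type) := gen_choiceMixin (fps R).

Definition fps0 (R : zmodType) : fps R := FPS (fun=> 0).
Definition fps_opp (R : zmodType) (f : fps R) : fps R := FPS (fun n => - f n).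
Definition fps_add (R : zmodType) (f g : fps R) : fps R :=
  FPS (fun n => f n + g n).

Lemma fps_addA (R : zmodType) : associative (@fps_add R).
Proof. by move=> f g h; apply: fpsP => n /=; rewrite addrA. Qed.
Lemma fps_addC (R : zmodType) : commutative (@fps_add R).
Proof. by move=> f g; apply: fpsP => n /=; rewrite addrC. Qed.
Lemma fps_add0 (R : zmodType) : left_id (@fps0 R) (@fps_add R).
Proof. by move=> f; apply: fpsP => n /=; rewrite add0r. Qed.
Lemma fps_addN (R : zmodType) :
  left_inverse (@fps0 R) (@fps_opp R) (@fps_add R).
Proof. by move=> f; apply: fpsP => n /=; rewrite addNr. Qed.

HB.instance Definition _ (R : zmodType) := GRing.isZmodule.Build (fps R)
  (@fps_addA R) (@fps_addC R) (@fps_add0 R) (@fps_addN R).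

Definition fps1 (R : comNzRingType) : fps R := FPS (fun n => (n == 0)%:R).
Definition fps_mul (R : comNzRingType) (f g : fps R) : fps R :=
  FPS (fun n => \sum_(i < n.+1) f i * g (n - i)%N).

Definition ftrunc (R : comNzRingType) (m : nat) (f : fps R) : {poly R} :=
  \poly_(i < m.+1) f i.

Lemma coef_ftrunc (R : comNzRingType) (m : nat) (f : fps R) (n : nat) :
  (n <= m)%N -> (ftrunc m f)`_n = f n.
Proof. by move=> nm; rewrite coef_poly ltnS nm. Qed.

Lemma fps_mul_trunc (R : comNzRingType) (m : nat) (f g : fps R) (n : nat) :
  (n <= m)%N -> fps_mul f g n = (ftrunc m f * ftrunc m g)`_n.
Proof.
move=> nm; rewrite coefM; apply: eq_bigr => i _.
by rewrite !coef_ftrunc// (leq_trans _ nm)// ?leq_subr// -ltnS.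
Qed.

Lemma fps_mulC (R : comNzRingType) : commutative (@fps_mul R).
Proof.
by move=> f g; apply: fpsP => n; rewrite !(fps_mul_trunc _ _ (leqnn n)) mulrC.
Qed.
Lemma fps_mulA (R : comNzRingType) : associative (@fps_mul R).
Proof.
move=> f g h; apply: fpsP => n.
transitivity (ftrunc n f * (ftrunc n g * ftrunc n h))`_n.
  rewrite coefM; apply: eq_bigr => i _.
  by rewrite coef_ftrunc -1?ltnS// (fps_mul_trunc (m := n))// leq_subr.
rewrite mulrA coefM; apply: eq_bigr => i _.
by rewrite coef_ftrunc ?leq_subr// (fps_mul_trunc (m := n))// -ltnS.
Qed.
Lemma fps_mul1 (R : comNzRingType) : left_id (@fps1 R) (@fps_mul R).
Proof.
move=> f; apply: fpsP => n /=; rewrite big_ord_recl/= mul1r subn0.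
by rewrite big1 ?addr0// => i _; rewrite mul0r.
Qed.
Lemma fps_mulDl (R : comNzRingType) :
  left_distributive (@fps_mul R) (@fps_add R).
Proof.
move=> f g h; apply: fpsP => n /=; rewrite -big_split/=.
by apply: eq_bigr => i _; rewrite mulrDl.
Qed.
Lemma fps1_neq0 (R : comNzRingType) : fps1 R != 0.
Proof.
apply/eqP => /(congr1 (fun f : fps R => f 0%N))/=.
by move/eqP; rewrite oner_eq0.
Qed.

HB.instance Definition _ (R : comNzRingType) :=
  GRing.Zmodule_isComNzRing.Build (fps R) (@fps_mulA R) (@fps_mulC R)
    (@fps_mul1 R) (@fps_mulDl R) (@fps1_neq0 R).

Lemma fcoefD (R : comNzRingType) (f g : fps R) (n : nat) :
  (f + g) n = f n + g n.
Proof. by []. Qed.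
Lemma fcoefN (R : comNzRingType) (f : fps R) (n : nat) : (- f) n = - f n.
Proof. by []. Qed.
Lemma fcoef1 (R : comNzRingType) (n : nat) : (1 : fps R) n = (n == 0)%:R.
Proof. by []. Qed.
Lemma fcoefM (R : comNzRingType) (f g : fps R) (n : nat) :
  (f * g) n = \sum_(i < n.+1) f i * g (n - i)%N.
Proof. by []. Qed.
Lemma fcoefM0 (R : comNzRingType) (f g : fps R) : (f * g) 0%N = f 0%N * g 0%N.
Proof. by rewrite fcoefM big_ord1. Qed.

(* [fps_inv_seq f n] lists the first n coefficients of the inverse of f. *)
Fixpoint fps_inv_seq (R : comUnitRingType) (f : fps R) (n : nat) : seq R :=
  if n is m.+1 then
    let s := fps_inv_seq f m in
    rcons s ((f 0%N)^-1 * ((m == 0)%:R - \sum_(i < m) s`_i * f (m - i)%N))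
  else [::].

Definition fps_unit (R : comUnitRingType) : pred (fps R) :=
  [pred f : fps R | f 0%N \is a GRing.unit].
Definition fps_inv (R : comUnitRingType) (f : fps R) : fps R :=
  if fps_unit f then FPS (fun n => (fps_inv_seq f n.+1)`_n) else f.

Lemma size_fps_inv_seq (R : comUnitRingType) (f : fps R) (n : nat) :
  size (fps_inv_seq f n) = n.
Proof. by elim: n => //= n IH; rewrite size_rcons IH. Qed.

Lemma nth_fps_inv_seq (R : comUnitRingType) (f : fps R) (m n : nat) :
  (n < m)%N -> (fps_inv_seq f m)`_n = (fps_inv_seq f n.+1)`_n.
Proof.
elim: m => // m IH; rewrite ltnS leq_eqVlt => /predU1P[->//|nm].
by rewrite [LHS]/= nth_rcons size_fps_inv_seq nm IH.
Qed.

Lemma fps_mulV (R : comUnitRingType) :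
  {in @fps_unit R, left_inverse 1 (@fps_inv R) *%R}.
Proof.
move=> f uf; apply: fpsP => n; rewrite fcoefM fcoef1 big_ord_recr/= subnn.
have -> : fps_inv f = FPS (fun n => (fps_inv_seq f n.+1)`_n).
  by rewrite /fps_inv ifT.
rewrite /= !nth_rcons size_fps_inv_seq ltnn eqxx.
rewrite (mulrC (f 0%N)^-1) divrK//.
rewrite (eq_bigr (fun i : 'I_n => (fps_inv_seq f n)`_i * f (n - i)%N)).
  by rewrite addrC subrK.
by move=> i _ /=; rewrite -(nth_fps_inv_seq f (ltn_ord i)).
Qed.
Lemma fps_unitPl (R : comUnitRingType) (f g : fps R) :
  g * f = 1 -> fps_unit f.
Proof.
move=> /(congr1 (fun h : fps R => h 0%N)); rewrite fcoefM0 fcoef1/= => gf.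
by apply/unitrPr; exists (g 0%N); rewrite mulrC.
Qed.
Lemma fps_inv_out (R : comUnitRingType) :
  {in [predC @fps_unit R], @fps_inv R =1 id}.
Proof. by move=> f nuf; rewrite /fps_inv ifN. Qed.

HB.instance Definition _ (R : comUnitRingType) :=
  GRing.ComNzRing_hasMulInverse.Build (fps R)
    (@fps_mulV R) (@fps_unitPl R) (@fps_inv_out R).

Definition fpsX (R : comNzRingType) : fps R := FPS (fun n => (n == 1)%:R).

(* Convergence in the q-adic topology: each coefficient is eventually
   constant. *)
Definition fps_cvg (R : comNzRingType) (u : nat -> fps R) (l : fps R) : Prop :=
  forall n, exists N, forall M, (N <= M)%N -> u M n = l n.

(* The value is the junk 0 for a divergent sequence. *)
Definition fps_lim (R : comNzRingType) (u : nat -> fps R) : fps R :=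
  xget 0 [set l | fps_cvg u l]%classic.

Lemma fps_cvg_unique (R : comNzRingType) (u : nat -> fps R) (l l' : fps R) :
  fps_cvg u l -> fps_cvg u l' -> l = l'.
Proof.
move=> ul ul'; apply: fpsP => n; have [N lN] := ul n; have [N' lN'] := ul' n.
by rewrite -(lN (maxn N N')) ?leq_maxl// lN' ?leq_maxr.
Qed.

Lemma fps_cvg_lim (R : comNzRingType) (u : nat -> fps R) (l : fps R) :
  fps_cvg u l -> fps_lim u = l.
Proof.
rewrite /fps_lim => ul.
by case: xgetP => [x _ /fps_cvg_unique/(_ ul)//|/(_ l)/(_ ul)].
Qed.

(* (a; q)_oo *)
Definition qpoch (R : comNzRingType) (a q : fps R) : fps R :=
  fps_lim (fun N => \prod_(i < N) (1 - a * q ^+ i)).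

Lemma fcoef_exp_small (R : comNzRingType) (a q : fps R) (i n : nat) :
  q 0%N = 0 -> (n < i)%N -> (a * q ^+ i) n = 0.
Proof.
move=> q0; elim: i n => // i IH n ni; rewrite exprSr mulrA fcoefM.
rewrite big1// => j _; have [->|jn] := eqVneq (j : nat) n.
  by rewrite subnn q0 mulr0.
rewrite IH ?mul0r// (leq_trans _ (_ : n <= i)%N)//.
by rewrite ltn_neqAle jn -ltnS ltn_ord.
Qed.

Lemma qpoch_cvg (R : comNzRingType) (a q : fps R) : q 0%N = 0 ->
  fps_cvg (fun N => \prod_(i < N) (1 - a * q ^+ i)) (qpoch a q).
Proof.
move=> q0; set u := fun N => _.
suff ul : fps_cvg u (FPS (fun n => u n.+1 n)).
  by rewrite /qpoch -/u (fps_cvg_lim ul).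
move=> n; exists n.+1; elim=> // M IH; rewrite leq_eqVlt => /predU1P[[<-]//|].
rewrite ltnS => nM; rewrite -IH//.
have -> : u M.+1 = u M * (1 - a * q ^+ M) by rewrite /u big_ord_recr.
by rewrite mulrBr mulr1 fcoefD fcoefN mulrA fcoef_exp_small ?subr0.
Qed.

Lemma qpoch_unit (R : comUnitRingType) (a q : fps R) :
  a 0%N = 0 -> q 0%N = 0 -> qpoch a q \is a GRing.unit.
Proof.
move=> a0 q0; suff q1 : qpoch a q 0%N = 1.
  by rewrite qualifE/= /fps_unit inE/= q1 unitr1.
have [N /(_ _ (leqnn N)) <-] := qpoch_cvg a q0 0.
elim: N => [|N IH]; first by rewrite big_ord0.
rewrite big_ord_recr; set x := \prod_(i < N) _ in IH *.
transitivity ((x * (1 - a * q ^+ N)) 0%N) => //.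
by rewrite fcoefM0 IH mul1r fcoefD fcoefN fcoefM0 a0 mul0r subr0.
Qed.

Local Open Scope nat_scope.

(* An overpartition is a sequence of parts, each paired with a boolean that
   is true when the part is overlined. *)

Definition parts (p : seq (nat * bool)) : seq nat := unzip1 p.

Definition is_overpartition (n : nat) (p : seq (nat * bool)) : bool :=
  [&& sorted geq (parts p), all (ltn 0) (parts p), sumn (parts p) == n
    & all (fun i => nth false (unzip2 p) i ==>
                    (index (nth 0 (parts p) i) (parts p) == i))
          (iota 0 (size p))].

Definition is_duplicate (s : nat) (p : seq (nat * bool)) : bool :=
  all (fun x => (1 < count_mem x (parts p)) ==> (s./2 %| x)) (parts p).

Definition duplicate_overpartitions (s n : nat) : set (seq (nat * bool)) :=
  [set p | is_overpartition n p && is_duplicate s p]%classic.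

Lemma finite_duplicate_overpartitions (s n : nat) :
  finite_set (duplicate_overpartitions s n).
Proof.
pose e (t : {bseq n of ('I_n.+1 * bool)}) : seq (nat * bool) :=
  [seq (val x.1, x.2) | x <- t].
apply: (@sub_finite_set _ _ (e @` [set: {bseq n of ('I_n.+1 * bool)}])%classic).
  move=> p /= /andP[/and4P[_ pos /eqP sump _] _].
  have szp : size p <= n.
    rewrite -sump; elim: p pos {sump} => //= -[x b] p IH /= /andP[x0 /IH].
    by move=> /leq_add; move=> /(_ _ _ x0); rewrite addn1 addnC.
  have le_p x : x \in p -> x.1 < n.+1.
    rewrite ltnS -sump; elim: p {pos sump szp} => //= y p IH.
    rewrite inE => /predU1P[->|/IH]; first exact: leq_addr.
    by move=> /leq_trans; apply; exact: leq_addl.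
  pose t := [seq (inord x.1 : 'I_n.+1, x.2) | x <- p].
  have szt : size t <= n by rewrite size_map.
  exists (Bseq szt) => //; rewrite /e /= -map_comp -[RHS]map_id.
  apply/eq_in_map => -[x b] /le_p xn /=; by rewrite inordK.
exact/finite_image/finite_finset.
Qed.

Definition nb_duplicate_overpartitions (s n : nat) : nat :=
  #|` fset_set (duplicate_overpartitions s n)|%fset.

(* Main.v *)
Require Import Defs.
From mathcomp Require Import all_boot all_order all_algebra finmap.
From mathcomp Require Import all_classical.
From mathcomp Require Import zify ring.

Set Implicit Arguments.
Unset Strict Implicit.
Unset Printing Implicit Defensive.

Import GRing.Theory.
Local Open Scope nat_scope.

(** Put m = s/2.  A duplicate overpartition is a sequence whose consecutive
    parts either decrease or repeat a multiple of m without an overline.  Let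
    A_k be the generating function of those with parts at most k, and H_k that
    of the sequences which may follow a part k.  Splitting off the first part,
    A_k = A_(k-1) + 2 q^k H_k and H_k = A_(k-1) + [m | k] q^k H_k, hence
    (1 - [m | k] q^k) A_k = (1 + (2 - [m | k]) q^k) A_(k-1).  By induction A_N
    is a quotient of finite q-Pochhammer products, and N tends to infinity.
    The second formula comes from (-Q; Q) (Q; Q) = (Q^2; Q^2). *)

(** * Duplicate overpartitions as sequences sorted by one relation *)

Definition dup_rel (m : nat) (a c : nat * bool) : bool :=
  (c.1 < a.1) || [&& c.1 == a.1, ~~ c.2 & m %| a.1].

Lemma dup_rel_trans (m : nat) : transitive (dup_rel m).
Proof.
move=> [y b1] [x b2] [z b3]; rewrite /dup_rel /=.
case/orP=> [yx|/and3P[/eqP-> _ mx]].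
  by move=> /orP[zy|/and3P[/eqP-> _ _]]; rewrite ?yx // (ltn_trans zy yx).
by case/orP=> [->//|/and3P[/eqP-> -> _]]; rewrite eqxx mx orbT.
Qed.

Definition dup_pred (m n : nat) (p : seq (nat * bool)) : bool :=
  [&& sorted (dup_rel m) p, all (ltn 0) (parts p) & sumn (parts p) == n].

Definition first_overlined (p : seq (nat * bool)) : bool :=
  all (fun i => nth false (unzip2 p) i ==>
                (index (nth 0 (parts p) i) (parts p) == i))
      (iota 0 (size p)).

(** A new head shifts all indices by one and takes over as first occurrence of its own value only,
    so exactly the later entries of that value lose the right to an overline. *)
Lemma first_overlined_cons (a : nat * bool) (p : seq (nat * bool)) :
  first_overlined (a :: p) =
  all (fun c => c.2 ==> (c.1 != a.1)) p && first_overlined p.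
Proof.
rewrite /first_overlined /= eqxx implybT /= -[1]addn0 iotaDl all_map.
have -> : all (fun c => c.2 ==> (c.1 != a.1)) p =
    all (fun i => (nth (0, false) p i).2 ==> ((nth (0, false) p i).1 != a.1))
      (iota 0 (size p)).
  by rewrite -{1}[p](mkseq_nth (0, false)) /mkseq all_map.
rewrite -all_predI.
apply: eq_in_all => i; rewrite mem_iota /= => ip.
rewrite add0n in ip.
rewrite /parts /unzip1 /unzip2 !(nth_map (0, false)) //= add1n.
set c := nth _ _ i; case: (c.2) => //=.
by case: (eqVneq a.1 c.1).
Qed.

(** The new head raises only the multiplicity of its own value; if that value recurs in [p], its
    divisibility is already the head's condition. *)
Lemma is_duplicate_cons (s : nat) (a : nat * bool) (p : seq (nat * bool)) :
  is_duplicate s (a :: p) =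
  ((a.1 \in parts p) ==> (s./2 %| a.1)) && is_duplicate s p.
Proof.
rewrite /is_duplicate /= eqxx -[1 < _]/(1 < 1 + _) -ltn_predRL /=.
rewrite -has_count has_pred1; apply: andb_id2l => sa.
apply: eq_in_all => x xp; have [ax|_] := eqVneq a.1 x; last by rewrite add0n.
by move: sa; rewrite ax xp /= => ->; rewrite !implybT.
Qed.

Lemma duplicate_overpartitionE (s n : nat) (p : seq (nat * bool)) :
  is_overpartition n p && is_duplicate s p = dup_pred s./2 n p.
Proof.
rewrite /dup_pred /is_overpartition -/(first_overlined p).
suff -> : sorted (dup_rel s./2) p =
    [&& sorted geq (parts p), first_overlined p & is_duplicate s p].
  move: (sorted _ _) (all _ _) (_ == _) (first_overlined p) (is_duplicate s p).
  by do 5!case.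
have geqT : transitive geq by move=> x y z /= xy zx; exact: leq_trans zx xy.
(* Both orders are transitive; in [pairwise] form all conditions unfold along the list, and only the
   comparison of the head with the later entries remains. *)
rewrite (sorted_pairwise (@dup_rel_trans _)) (sorted_pairwise geqT).
elim: p => // a p IH; rewrite first_overlined_cons is_duplicate_cons /= IH.
suff -> : all (dup_rel s./2 a) p =
    [&& all (geq a.1) (parts p), all (fun c => c.2 ==> (c.1 != a.1)) p
      & (a.1 \in parts p) ==> (s./2 %| a.1)].
  move: (all _ (parts p)) (all _ p) (_ ==> _) (pairwise _ _).
  by move: (first_overlined p) (is_duplicate s p); do 6!case.
elim: p {IH} => // c p IH; rewrite /= inE IH /dup_rel.
case: (ltngtP c.1 a.1) => //= _; rewrite ?implybT ?implybF //=.
case: (c.2) => /=; first by rewrite andbF.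
case: (s./2 %| a.1); rewrite /= ?implybT ?andbT ?andbF //=.
Qed.

(** * Explicit enumeration by largest part *)

(* Lists the sequences that may follow a part k, given the lists L of those
   with all parts below k; for k > 0 the fuel is enough when it is at least n. *)
Fixpoint extend_dup (m k : nat) (L : nat -> seq (seq (nat * bool)))
    (fuel n : nat) : seq (seq (nat * bool)) :=
  L n ++ (if fuel is f.+1 then
            if (m %| k) && (k <= n)
            then [seq (k, false) :: p | p <- extend_dup m k L f (n - k)]
            else [::]
          else [::]).

Fixpoint dup_enum (m k n : nat) : seq (seq (nat * bool)) :=
  if k is k'.+1 then
    dup_enum m k' n ++
    (if k <= n then
       [seq (k, true) :: p | p <- extend_dup m k (dup_enum m k') n (n - k)] ++
       [seq (k, false) :: p | p <- extend_dup m k (dup_enum m k') n (n - k)]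
     else [::])
  else if n == 0 then [:: [::]] else [::].

Definition head_le (k : nat) (p : seq (nat * bool)) : bool :=
  if p is c :: _ then c.1 <= k else true.

(** [dup_rel] ignores the overline of its first argument, so the flag [false] is arbitrary. *)
Definition head_rel (m k : nat) (p : seq (nat * bool)) : bool :=
  if p is c :: _ then dup_rel m (k, false) c else true.

Lemma dup_pred_cons (m n k : nat) (b : bool) (p : seq (nat * bool)) : 0 < k ->
  dup_pred m n ((k, b) :: p) =
  (k <= n) && (head_rel m k p && dup_pred m (n - k) p).
Proof.
move=> k0; rewrite /dup_pred /= k0 /=.
have -> : path (dup_rel m) (k, b) p = head_rel m k p && sorted (dup_rel m) p.
  by case: p.
have -> : (k + sumn (parts p) == n) = (k <= n) && (sumn (parts p) == n - k).
  by lia.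
by move: (head_rel _ _ _) (sorted _ _) (all _ _) (k <= n) (_ == _); do 5!case.
Qed.

Lemma mem_map_cons (T : eqType) (a c : T) (L : seq (seq T)) (p : seq T) :
  (c :: p \in [seq a :: x | x <- L]) = (c == a) && (p \in L).
Proof.
apply/mapP/andP => [[x xL [-> ->]]|[/eqP -> pL]]; last by exists p.
by rewrite eqxx.
Qed.

(** A follower of [k.+1] either has all parts at most [k], or begins with a plain [k.+1] and
    continues with a follower of smaller total. *)
Lemma mem_extend_dup (m k : nat) (L : nat -> seq (seq (nat * bool))) :
  (forall n p, (p \in L n) = dup_pred m n p && head_le k p) ->
  forall f n p, n <= f ->
  (p \in extend_dup m k.+1 L f n) = dup_pred m n p && head_rel m k.+1 p.
Proof.
move=> LP; elim=> [|f IH] n p nf; rewrite /= mem_cat LP.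
  (* Fuel 0 forces [n = 0], and no nonempty sequence of positive parts has sum 0. *)
  rewrite in_nil orbF; case: p => // -[x b] p.
  move: nf; rewrite leqn0 => /eqP ->.
  by rewrite /dup_pred /=; case: x => [|x]; rewrite ?andbF.
case: p => [|[x b] p].
  by rewrite /= andbT; case: ifP => _; rewrite ?in_nil ?orbF //;
    case: (dup_pred _ _ _) => //=; apply/mapP => -[].
rewrite /head_le /head_rel /dup_rel /= ltnS.
have -> : ((x, b) :: p \in if (m %| k.+1) && (k < n)
     then [seq (k.+1, false) :: p0 | p0 <- extend_dup m k.+1 L f (n - k.+1)]
     else [::]) = [&& x == k.+1, ~~ b, m %| k.+1 & dup_pred m n ((x, b) :: p)].
  case: (altP (x =P k.+1)) => [->|xk]; last first.
    by case: ifP => _ //; rewrite mem_map_cons xpair_eqE (negPf xk).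
  rewrite dup_pred_cons //; case: ifP => [/andP[-> kn]|mk].
    rewrite mem_map_cons xpair_eqE eqxx /= IH; last by lia.
    rewrite kn /= andbC [_ && head_rel _ _ _]andbC.
    by case: b; rewrite ?andbF ?andbT.
  by rewrite in_nil [(m %| _) && _]andbA mk andbF.
by case: (dup_pred _ _ _); rewrite ?andbF ?andbT.
Qed.

Lemma mem_dup_enum (m k n : nat) (p : seq (nat * bool)) :
  (p \in dup_enum m k n) = dup_pred m n p && head_le k p.
Proof.
elim: k n p => [|k IH] n p.
  rewrite /=; case: p => [|[x b] p].
    by rewrite /dup_pred /= andbT eq_sym; case: ifP => _; rewrite inE.
  rewrite /dup_pred /= leqn0; case: ifP => _; rewrite inE; case: x => [|x];
    by rewrite /= ?andbF.
rewrite /= mem_cat IH; case: p => [|[x b] p].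
  rewrite /= andbT; case: ifP => _; rewrite ?in_nil ?orbF // mem_cat.
  case: (dup_pred _ _ _) => //=; apply/negbTE; rewrite negb_or.
  by apply/andP; split; apply/mapP => -[].
have -> : head_le k.+1 ((x, b) :: p) = head_le k ((x, b) :: p) || (x == k.+1).
  by rewrite /=; lia.
rewrite andb_orr; congr (_ || _).
have [->|xk] := altP (x =P k.+1); last first.
  rewrite andbF; case: ifP => _ //; rewrite mem_cat !mem_map_cons !xpair_eqE.
  by rewrite (negPf xk).
rewrite dup_pred_cons // andbT; case: ifP => // kn.
rewrite mem_cat !mem_map_cons !xpair_eqE eqxx /= -andb_orl.
rewrite (mem_extend_dup IH) ?leq_subr // [_ && head_rel _ _ _]andbC.
by case: b.
Qed.

Lemma cons_inj (T : Type) (a : T) : injective (cons a).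
Proof. by move=> x y []. Qed.

(** The two halves are disjoint: heads are at most [k] in [L n] and equal to [k.+1] in the other. *)
Lemma uniq_extend_dup (m k : nat) (L : nat -> seq (seq (nat * bool))) :
  (forall n, uniq (L n)) ->
  (forall n p, (p \in L n) = dup_pred m n p && head_le k p) ->
  forall f n, uniq (extend_dup m k.+1 L f n).
Proof.
move=> Lu LP; elim=> [|f IH] n /=; first by rewrite cats0.
rewrite cat_uniq Lu /=; case: ifP => // _.
rewrite map_inj_uniq ?IH ?andbT; last exact: cons_inj.
by apply/hasPn => _ /mapP[p _ ->]; rewrite /= LP /= ltnn andbF.
Qed.

Lemma uniq_dup_enum (m k n : nat) : uniq (dup_enum m k n).
Proof.
elim: k n => [|k IH] n /=; first by case: ifP.
rewrite cat_uniq IH /=; case: ifP => // _.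
have uE f i : uniq (extend_dup m k.+1 (dup_enum m k) f i).
  by apply: uniq_extend_dup => // ??; exact: mem_dup_enum.
rewrite cat_uniq !map_inj_uniq ?uE /= ?andbT; try exact: cons_inj.
apply/andP; split; apply/hasPn => p.
  rewrite mem_cat => /orP[] /mapP[x _ ->];
    by rewrite /= mem_dup_enum /= ltnn andbF.
by move=> /mapP[x _ ->]; rewrite /= mem_map_cons xpair_eqE andbF.
Qed.

(** No part exceeds the total, so the bound [k] on the head excludes nothing. *)
Lemma nb_duplicate_overpartitionsE (s k n : nat) : n <= k ->
  nb_duplicate_overpartitions s n = size (dup_enum s./2 k n).
Proof.
move=> nk; rewrite /nb_duplicate_overpartitions.
rewrite -(undup_id (uniq_dup_enum _ _ _)).
rewrite -card_fseq; congr #|` _|%fset; apply/fsetP => p.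
rewrite in_fset_set; last exact: finite_duplicate_overpartitions.
rewrite in_fset mem_dup_enum.
have -> : (p \in duplicate_overpartitions s n) = dup_pred s./2 n p.
  by rewrite -duplicate_overpartitionE; apply/idP/idP; rewrite inE.
case: (boolP (dup_pred _ n p)) => // dp; case: p dp => // -[x b] p.
by case/and3P=> _ _ /eqP sump; rewrite /= (leq_trans _ nk) // -sump leq_addr.
Qed.

(** * Generating functions and their recurrence *)

Local Open Scope ring_scope.

Lemma fcoefXnM (R : comNzRingType) (k : nat) (f : fps R) (n : nat) :
  (fpsX R ^+ k * f) n = if (k <= n)%N then f (n - k)%N else 0.
Proof.
elim: k n => [|k IH] n; first by rewrite expr0 mul1r subn0.
have X1 (g : fps R) i : (fpsX R * g) i = if i is j.+1 then g j else 0.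
  rewrite fcoefM big_ord_recl /= mul0r add0r.
  case: i => [|i]; first by rewrite big_ord0.
  rewrite big_ord_recl /= mul1r big1 ?addr0 ?subn1 //.
  by move=> j _; rewrite mul0r.
by rewrite exprS -mulrA X1; case: n => // n; rewrite IH ltnS subSS.
Qed.

Definition dup_gf (m k : nat) : fps int :=
  FPS (fun n => (size (dup_enum m k n))%:Z).

(** This is H_(k+1): the shift keeps the part positive, so that fuel [n] suffices for total [n]. *)
Definition ext_gf (m k : nat) : fps int :=
  FPS (fun n => (size (extend_dup m k.+1 (dup_enum m k) n n))%:Z).

Lemma extend_dup_fuel (m k : nat) L (f g n : nat) : (n <= f)%N -> (n <= g)%N ->
  extend_dup m k.+1 L f n = extend_dup m k.+1 L g n.
Proof.
elim: f g n => [|f IH] [|g] n //= nf ng.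
- by have -> : ((m %| k.+1) && (k < n))%N = false by lia.
- by have -> : ((m %| k.+1) && (k < n))%N = false by lia.
by rewrite (IH g) //; lia.
Qed.

Lemma ext_gfE (m k : nat) :
  (1 - (m %| k.+1)%:R * fpsX int ^+ k.+1) * ext_gf m k = dup_gf m k.
Proof.
rewrite mulrBl mul1r; apply/eqP; rewrite subr_eq; apply/eqP/fpsP => n.
rewrite fcoefD.
have -> : ((m %| k.+1)%:R * fpsX int ^+ k.+1 * ext_gf m k) n =
    if (m %| k.+1)%N && (k < n)%N then ext_gf m k (n - k.+1)%N else 0.
  rewrite -mulrA; case: (_ %| _)%N; last by rewrite mul0r.
  by rewrite mul1r fcoefXnM.
case: n => [|n]; first by rewrite andbF /= cats0 addr0.
rewrite [LHS]/= size_cat PoszD; congr (_ + _); case: ifP => // _.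
by rewrite size_map /= (@extend_dup_fuel _ _ _ n (n.+1 - k.+1)) //; lia.
Qed.

Lemma dup_gfS (m k : nat) :
  dup_gf m k.+1 = dup_gf m k + 2 * fpsX int ^+ k.+1 * ext_gf m k.
Proof.
apply: fpsP => n; rewrite fcoefD [LHS]/= size_cat PoszD; congr (_ + _).
rewrite -mulrA mulr_natl mulr2n fcoefD fcoefXnM; case: ifP => // kn.
rewrite size_cat !size_map PoszD /=.
by rewrite (@extend_dup_fuel _ _ _ n (n - k.+1)) //; lia.
Qed.

Lemma dup_gf_rec (m k : nat) :
  (1 - (m %| k.+1)%:R * fpsX int ^+ k.+1) * dup_gf m k.+1 =
  (1 + (2 - (m %| k.+1)%:R) * fpsX int ^+ k.+1) * dup_gf m k.
Proof. by rewrite dup_gfS -ext_gfE; ring. Qed.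

(** * Finite product formula *)

Definition qpochn (R : comNzRingType) (a q : fps R) (N : nat) : fps R :=
  \prod_(i < N) (1 - a * q ^+ i).

Lemma qpochnS (R : comNzRingType) (a q : fps R) (N : nat) :
  qpochn a q N.+1 = qpochn a q N * (1 - a * q ^+ N).
Proof. exact: big_ord_recr. Qed.

(** The product of all 1 + 2q^k is wrong at multiples of m, where the factor should be (1 + q^k)/(1
    - q^k); the products in [Q] correct this. Denominators are cleared. *)
Lemma dup_gf_prod (m N : nat) (q := fpsX int) (Q : fps int := q ^+ m) :
  (0 < m)%N ->
  dup_gf m N * (qpochn (- (2 * Q)) Q (N %/ m) * qpochn Q Q (N %/ m)) =
  qpochn (- (2 * q)) q N * qpochn (- Q) Q (N %/ m).
Proof.
move=> m0; elim: N => [|N IH].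
  rewrite div0n /qpochn !big_ord0 !mulr1; apply: fpsP => n.
  by rewrite fcoef1 /=; case: eqP.
have rec := dup_gf_rec m N; rewrite divnS // qpochnS.
case: (boolP (m %| N.+1)%N) rec => [mN|_]; last first.
  rewrite add0n mul0r !subr0 mul1r => ->.
  by rewrite -[LHS]mulrA IH exprS -/q; ring.
(* When m divides N+1, the quotient by m grows by one and q^(N+1) is the next power of [Q]. *)
have QN : q ^+ N.+1 = Q * Q ^+ (N %/ m).
  rewrite -exprS -exprM; congr (_ ^+ _).
  by rewrite -[LHS](divnK mN) divnS // mN add1n mulnC.
have -> : - (2 * q) * q ^+ N = - (2 * (Q * Q ^+ (N %/ m))).
  by rewrite -QN exprS; ring.
rewrite add1n !qpochnS -/q QN mulr1n mul1r => rec.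
transitivity ((1 - - (2 * (Q * Q ^+ (N %/ m)))) *
   ((1 - Q * Q ^+ (N %/ m)) * dup_gf m N.+1) *
   (qpochn (- (2 * Q)) Q (N %/ m) * qpochn Q Q (N %/ m))); first by ring.
rewrite rec; transitivity ((1 - - (2 * (Q * Q ^+ (N %/ m)))) *
  (1 + Q * Q ^+ (N %/ m)) * (dup_gf m N *
   (qpochn (- (2 * Q)) Q (N %/ m) * qpochn Q Q (N %/ m)))); first by ring.
by rewrite IH; ring.
Qed.

(** * Passage to the limit *)

Lemma fps_cvgM (R : comNzRingType) (u v : nat -> fps R) (a b : fps R) :
  fps_cvg u a -> fps_cvg v b -> fps_cvg (fun N => u N * v N) (a * b).
Proof.
move=> ua vb n.
(* Coefficient [n] of a product involves only coefficients up to [n], which share a common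
   threshold. *)
have bound (w : nat -> fps R) (c : fps R) : fps_cvg w c ->
    exists N, forall M i, (N <= M)%N -> (i <= n)%N -> w M i = c i.
  move=> wc; elim: n => [|k [N1 H1]].
    have [N H] := wc 0%N; exists N => M i NM; rewrite leqn0 => /eqP ->.
    exact: H.
  have [N2 H2] := wc k.+1; exists (maxn N1 N2) => M i.
  rewrite geq_max => /andP[M1 M2]; rewrite leq_eqVlt ltnS => /orP[/eqP->|ik].
    exact: H2.
  exact: H1.
have [N1 H1] := bound _ _ ua; have [N2 H2] := bound _ _ vb.
exists (maxn N1 N2) => M; rewrite geq_max => /andP[M1 M2].
rewrite !fcoefM; apply: eq_bigr => i _.
by rewrite H1 ?H2 ?leq_subr // -ltnS.
Qed.

Lemma fps_cvg_divn (R : comNzRingType) (m : nat) (u : nat -> fps R) (a : fps R) :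
  (0 < m)%N -> fps_cvg u a -> fps_cvg (fun N => u (N %/ m)%N) a.
Proof.
move=> m0 ua n; have [N H] := ua n; exists (N * m)%N => M NM.
by apply: H; rewrite leq_divRL.
Qed.

Lemma dup_gf_cvg (s : nat) : fps_cvg (dup_gf s./2)
  (FPS (fun n => (nb_duplicate_overpartitions s n)%:Z)).
Proof.
by move=> n; exists n => M nM /=; rewrite (@nb_duplicate_overpartitionsE _ M).
Qed.

(** Factors of equal index pair up as differences of squares at every finite stage. *)
Lemma qpoch_sqr (R : comNzRingType) (Q : fps R) : Q 0%N = 0 ->
  qpoch (- Q) Q * qpoch Q Q = qpoch (Q ^+ 2) (Q ^+ 2).
Proof.
move=> Q0; have Q20 : (Q ^+ 2) 0%N = 0 by rewrite expr2 fcoefM0 Q0 mul0r.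
apply: fps_cvg_unique (qpoch_cvg (Q ^+ 2) Q20).
have := fps_cvgM (qpoch_cvg (- Q) Q0) (qpoch_cvg Q Q0).
congr fps_cvg; apply/funext => N; rewrite -big_split /=.
by apply: eq_bigr => i _; rewrite -exprM mulnC exprM; ring.
Qed.

Theorem theorem18 (s : nat) (s_ge4 : (4 <= s)%N) (s_even : ~~ odd s) :
  let q : fps int := fpsX int in
  let Q : fps int := q ^+ s./2 in
  FPS (fun n => (nb_duplicate_overpartitions s n)%:Z)
    = (qpoch (- (2 * q)) q * qpoch (- Q) Q)
      / (qpoch (- (2 * Q)) Q * qpoch Q Q)
  /\
  (qpoch (- (2 * q)) q * qpoch (- Q) Q)
      / (qpoch (- (2 * Q)) Q * qpoch Q Q)
    = (qpoch (- (2 * q)) q * qpoch (q ^+ s) (q ^+ s))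
      / (qpoch (- (2 * Q)) Q * qpoch Q Q ^+ 2).
Proof.
move=> q Q.
have m0 : (0 < s./2)%N by lia.
have q0 : q 0%N = 0 by [].
have Q0 : Q 0%N = 0.
  by rewrite -[Q]mulr1 fcoefXnM leqNgt m0.
have Q20 : (- (2 * Q)) 0%N = 0 by rewrite fcoefN fcoefM0 Q0 mulr0 oppr0.
have uB := qpoch_unit Q20 Q0; have uQ := qpoch_unit Q0 Q0.
have uBQ : qpoch (- (2 * Q)) Q * qpoch Q Q \is a GRing.unit by rewrite unitrM uB.
split.
  (* With the unit denominator cleared, both sides are limits of the two sides of [dup_gf_prod]. *)
  apply: (mulIr uBQ); rewrite divrK //.
  have cB := fps_cvg_divn m0 (qpoch_cvg (- (2 * Q)) Q0).
  have cQ := fps_cvg_divn m0 (qpoch_cvg Q Q0).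
  have cN := fps_cvg_divn m0 (qpoch_cvg (- Q) Q0).
  apply: fps_cvg_unique (fps_cvgM (dup_gf_cvg s) (fps_cvgM cB cQ)) _.
  have := fps_cvgM (qpoch_cvg (- (2 * q)) q0) cN.
  by congr fps_cvg; apply/funext => N; rewrite dup_gf_prod.
have -> : q ^+ s = Q ^+ 2.
  by rewrite -exprM; congr (_ ^+ _); lia.
(* The extra factor [qpoch Q Q] in the numerator cancels one of the two in the denominator. *)
rewrite -qpoch_sqr // expr2 !mulrA invrM // ?unitrM ?uB ?uQ //.
rewrite [in RHS]invrM // ?unitrM ?uB ?uQ //.
rewrite [RHS]mulrA mulrK // invrM //.
Qed.
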